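(* Let $q$ be a prime power, $k,h\ge 1$ integers, $r$ a proper divisor of $h$, and $h=rt$. Let $\Theta_r\simeq \mathrm{PG}(kt-1,q^r)$, the Desarguesian $(r-1)$-spread $\mathcal D_r$ of $\Pi\simeq\mathrm{PG}(kh-1,q)$ with director space $\Theta_r$, the system $\mathcal R^r_{h,q}$ and the generalized Segre variety $\mathcal S^r_{kr-1,h-1}(q)\subset\Pi$ be as defined in the context. Then: (i) There is a Segre variety $\mathcal S_{k-1,t-1}(q^r)$ of $\Theta_r$ such that $\mathcal S^r_{kr-1,h-1}(q)$ is the union of the elements of $\mathcal D_r$ corresponding to the points of $\mathcal S_{k-1,t-1}(q^r)$, and such that the elements of $\mathcal R^r_{h,q}$ are exactly the subspaces of $\Pi$ obtained as the unions of the elements of $\mathcal D_r$ corresponding to the points of the members of the $(t-1)$-regulus $\mathcal R_{t,q^r}$ of $\mathcal S_{k-1,t-1}(q^r)$. (ii) Let $\mathcal R^r_{kr,q}$ be the set of subspaces of $\Pi$ obtained as the unions of the elements of $\mathcal D_r$ corresponding to the points of the members of the $(k-1)$-regulus $\mathcal R_{k,q^r}$ of $\mathcal S_{k-1,t-1}(q^r)$. Then $\mathcal R^r_{kr,q}$ consists of $\frac{q^h-1}{q^r-1}$ mutually disjoint $(kr-1)$-dimensional subspaces of $\Pi$ partitioning $\mathcal S^r_{kr-1,h-1}(q)$. (iii) For every $\Gamma\in\mathcal R^r_{h,q}$, the set $\{\Gamma\cap\Gamma' : \Gamma'\in\mathcal R^r_{kr,q}\}$ is a Desarguesian $(r-1)$-spread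 of $\Gamma$; for every $\Lambda\in\mathcal R^r_{kr,q}$, the set $\{\Lambda\cap\Lambda' : \Lambda'\in\mathcal R^r_{h,q}\}$ is a Desarguesian $(r-1)$-spread of $\Lambda$.
   Context: All dimensions of subspaces are projective; a proper divisor $r$ of $h$ satisfies $1\le r<h$. For $v\in\mathbb F_{q^h}^k$ let $v^\sigma$ be obtained by raising every entry to the $q$-th power. Let $\overline{\mathcal M}$ be the space of $h\times k$ matrices over $\mathbb F_{q^h}$, with projective space $\mathrm{PG}(kh-1,q^h)$, and let $\psi$ be the collineation induced by sending the matrix with rows $v_1,\dots,v_h$ to the one with rows $v_h^\sigma,v_1^\sigma,\dots,v_{h-1}^\sigma$. It has order $h$ and its fixed points form the $q$-order subgeometry $\Pi\simeq \mathrm{PG}(kh-1,q)$ of points represented by nonzero Moore matrices $M_v$ (rows $v,v^\sigma,\dots,v^{\sigma^{h-1}}$), $v\in\mathbb F_{q^h}^k$. For $v\neq\mathbf 0$, $\pi_v$ is the $(h-1)$-dimensional subspace of $\Pi$ whose points are represented by $M_{\alpha v}$, $\alpha\in\mathbb F_{q^h}\setminus\{0\}$. Generalized Segre variety: $\mathcal R^r_{h,q}=\{\pi_v: v\in\mathbb F_{q^r}^k\setminus\{\mathbf 0\}\}$, and $\mathcal S^r_{kr-1,h-1}(q)$ is the set of points of $\Pi$ lying on elements of $\mathcal R^r_{h,q}$. The space $\Theta_r$: the fixed points of $\psi^r$ form a $q^r$-order subgeometry $\Pi_r\simeq\mathrm{PG}(kh-1,q^r)$ containing $\Pi$. Let $\Theta$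 be the $(k-1)$-dimensional subspace of $\mathrm{PG}(kh-1,q^h)$ of matrices whose only nonzero entries are in the first row, and $\Theta_r=\Pi_r\cap\langle\Theta,\Theta^{\psi^r},\dots,\Theta^{\psi^{r(t-1)}}\rangle_{q^h}\simeq \mathrm{PG}(kt-1,q^r)$. Its points are represented by the matrices with rows $w,w^{\sigma^r},\dots,w^{\sigma^{r(t-1)}}$ in positions $1,r+1,\dots,r(t-1)+1$ and zero rows elsewhere, $w\in\mathbb F_{q^h}^k\setminus\{\mathbf 0\}$, where $w$ is determined up to a nonzero scalar of $\mathbb F_{q^r}$. To a point $X\in\Theta_r$ corresponds the $(r-1)$-dimensional subspace $\langle X,X^\psi,\dots,X^{\psi^{r-1}}\rangle_{q^r}\cap\Pi$ (the span taken in $\Pi_r$) of $\Pi$; for $X$ given by $w$, its points are represented by $M_{\lambda w}$, $\lambda\in\mathbb F_{q^r}\setminus\{0\}$. The set of all these subspaces is the Desarguesian $(r-1)$-spread $\mathcal D_r$ of $\Pi$. Segre varieties: $\mathcal S_{k-1,t-1}(Q)\subset\mathrm{PG}(kt-1,Q)$ is, up to projectivity, the image of $\mathrm{PG}(k-1,Q)\times\mathrm{PG}(t-1,Q)\to\mathrm{PG}(kt-1,Q)$, $((x_i),(y_j))\mapsto(x_iy_j)$. Its $(t-1)$-regulus $\mathcal R_{t,Q}$ consists of the $(t-1)$-dimensional subspaces obtained by fixing a point of $\mathrm{PG}(k-1,Q)$ and letting the other one vary; its $(k-1)$-regulus $\mathcal R_{k,Q}$ consists of the $(k-1)$-dimensional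 subspaces obtained by fixing a point of $\mathrm{PG}(t-1,Q)$. Desarguesian spread: an $(r-1)$-spread of $\mathrm{PG}(mr-1,q)$ (partition of the points into $(r-1)$-dimensional subspaces) that is projectively equivalent to the one obtained by viewing the one-dimensional $\mathbb F_{q^r}$-subspaces of $\mathbb F_{q^r}^m$ as $r$-dimensional $\mathbb F_q$-subspaces of $\mathbb F_{q^r}^m\simeq\mathbb F_q^{mr}$. *)

(* Defs.v *)
From HB Require Import structures.
From mathcomp Require Import all_boot all_order all_algebra.

Set Implicit Arguments.
Unset Strict Implicit.
Unset Printing Implicit Defensive.

Import GRing.Theory.
Local Open Scope ring_scope.

(* Throughout, L is a field with q ^ h elements.  Points are 1-dimensional
   L-subspaces of 'M[L]_(h, k), seen as finite sets of matrices; a projective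
   subspace, a subgeometry or a variety is the set of its points. *)
Section GeneralizedSegre.

Variables (q : nat) (L : finFieldType) (h k : nat).

Local Notation V := 'M[L]_(h, k).
Local Notation pointT := {set 'M[L]_(h, k)}.
Local Notation pointsT := {set {set 'M[L]_(h, k)}}.

(* The subfield of order q ^ s of L, when s divides h. *)
Definition Fq (s : nat) : {pred L} := [pred x | x ^+ (q ^ s) == x].

(* The nonzero m x n matrices over the subfield of order q ^ s: coordinate
   vectors of the points of PG(mn - 1, q ^ s). *)
Definition nzmx (s m n : nat) : {set 'M[L]_(m, n)} :=
  [set x | (x != 0) && (x \is a mxOver (Fq s))].

Definition pt (A : V) : pointT := [set B in <[A]>%VS].

Definition PG : pointsT := [set pt A | A in [set~ 0]].

Definition lspan (S : pointsT) : {vspace V} := <<enum (cover S)>>%VS.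

Definition join (S : pointsT) : pointsT := [set P in PG | P \subset lspan S].

(* The matrix with rows v_1, ..., v_h is sent to the one with rows
   v_h^sigma, v_1^sigma, ..., v_(h-1)^sigma; ord_pred is cyclic. *)
Definition psi_mx (A : V) : V := \matrix_(i, j) (A (ord_pred i) j) ^+ q.

Definition psi (P : pointT) : pointT := psi_mx @: P.

Definition Pi_ (r : nat) : pointsT := [set P in PG | iter r psi P == P].

Definition Pi : pointsT := Pi_ 1.

(* S is a d-dimensional (projectively) subspace of a subgeometry Sigma: the
   subspaces of Sigma are the intersections with Sigma of L-subspaces, and
   linear independence of points of Sigma over its own field agrees with
   linear independence over L. *)
Definition subspace_of (Sigma : pointsT) (d : nat) (S : pointsT) : bool :=
  (S == Sigma :&: join S) && (\dim (lspan S) == d.+1).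

Definition moore (v : 'rV[L]_k) : V := \matrix_(i, j) (v 0 j) ^+ (q ^ i).

Definition pi_ (v : 'rV[L]_k) : pointsT :=
  [set pt (moore (a *: v)) | a in [set~ (0 : L)]].

Definition Rh (r : nat) : {set pointsT} := [set pi_ v | v in nzmx r 1 k].

Definition genSegre (r : nat) : pointsT := cover (Rh r).

Definition Theta : pointsT :=
  [set P in PG | [forall A in P, forall i : 'I_h, forall j : 'I_k,
                    (i != 0 :> nat) ==> (A i j == 0)]].

Definition Theta_ (r t : nat) : pointsT :=
  Pi_ r :&: join (\bigcup_(i < t) [set iter (r * i) psi P | P in Theta]).

(* The subspace of Pi corresponding to the point X of Theta_r; the inner
   intersection is the span taken in Pi_r. *)
Definition spread_elt (r : nat) (X : pointT) : pointsT :=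
  (Pi_ r :&: join [set iter i psi X | i : 'I_r]) :&: Pi.

Definition spread_union (r : nat) (S : pointsT) : pointsT :=
  \bigcup_(X in S) spread_elt r X.

Definition comb (m n : nat) (e : 'I_m -> 'I_n -> V) (x : 'M[L]_(m, n)) : V :=
  \sum_i \sum_j x i j *: e i j.

(* <x> |-> <comb e x> is a projectivity from PG(mn - 1, q ^ s) onto the
   subgeometry Sigma; the coordinates of PG(mn - 1, q ^ s) are indexed by
   'I_m * 'I_n. *)
Definition projectivity (s m n : nat) (e : 'I_m -> 'I_n -> V)
    (Sigma : pointsT) : bool :=
  free [seq e ij.1 ij.2 | ij : 'I_m * 'I_n] &&
  (Sigma == [set pt (comb e x) | x in nzmx s m n]).

(* The Segre variety S_{m-1,n-1}(q ^ s) transported by e: the coordinates of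
   the image of ((x_i), (y_j)) are (x_i y_j) = x^T *m y. *)
Definition segre (s m n : nat) (e : 'I_m -> 'I_n -> V) : pointsT :=
  [set pt (comb e (x^T *m y)) | x in nzmx s 1 m, y in nzmx s 1 n].

(* The (n-1)-regulus: the point x of PG(m - 1, q ^ s) is fixed. *)
Definition regulus_fst (s m n : nat) (e : 'I_m -> 'I_n -> V) : {set pointsT} :=
  [set [set pt (comb e (x^T *m y)) | y in nzmx s 1 n] | x in nzmx s 1 m].

(* The (m-1)-regulus: the point y of PG(n - 1, q ^ s) is fixed. *)
Definition regulus_snd (s m n : nat) (e : 'I_m -> 'I_n -> V) : {set pointsT} :=
  [set [set pt (comb e (x^T *m y)) | x in nzmx s 1 m] | y in nzmx s 1 n].

(* D is a d-spread of the subspace G of Pi. *)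
Definition is_spread (d : nat) (G : pointsT) (D : {set pointsT}) : bool :=
  partition D G && [forall S in D, subspace_of G d S].

(* The entries of b form a basis of F_{q ^ r} over F_q. *)
Definition is_Fq_basis (r : nat) (b : 'cV[L]_r) : Prop :=
  b \is a mxOver (Fq r) /\
  forall a, a \in Fq r ->
    exists! z : 'rV[L]_r, z \is a mxOver (Fq 1) /\ z *m b = a%:M.

(* A basis b of F_{q ^ r} over F_q identifies x in F_q^(m x r) with the vector
   x *m b of F_{q ^ r}^m; the line F_{q ^ r} w becomes a subspace of
   PG(mr - 1, q), carried to G by the projectivity given by e. *)
Definition desarguesian_spread (r m : nat) (G : pointsT) (D : {set pointsT}) :
    Prop :=
  is_spread r.-1 G D /\
  exists (b : 'cV[L]_r) (e : 'I_m -> 'I_r -> V),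
    [/\ is_Fq_basis b,
        projectivity 1 e G &
        D = [set [set pt (comb e x) | x in [set x in nzmx 1 m r |
                    [exists a in Fq r, x *m b == a *: w]]]
            | w in nzmx r m 1]].

End GeneralizedSegre.

(* Main.v *)
Require Import Defs.
From mathcomp Require Import all_boot all_order all_algebra.
From mathcomp Require Import finfield.

(** Every object is described by row vectors of F_{q^h}^k.  The points of
    Theta_r are the matrices with rows w^(q^i) in the positions i divisible by
    r and zero elsewhere, w being unique up to F_{q^r}^*, and the element of D_r
    through such a point is {M_(lambda w) : lambda in F_{q^r}^*}.  Hence an
    F_{q^r}-subspace of F_{q^h}^k yields a subspace of Pi together with a
    Desarguesian spread of it.  The two systems come from the F_{q^r}-subspaces
    F_{q^h} x and a F_{q^r}^k, for x in F_{q^r}^k and a in F_{q^h}^*, which meet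
    in F_{q^r} a x.  Linear independence over the big field is always obtained
    by descent: vectors fixed by the semilinear map psi^s are independent over
    F_{q^h} as soon as they are independent over F_{q^s}. *)

(** * Partitions given as images, and coefficients in spans of families *)

Section Prerequisites.

Set Implicit Arguments.
Unset Strict Implicit.
Unset Printing Implicit Defensive.

Import GRing.Theory.
Local Open Scope ring_scope.

(** The index set may be redundant: the members below are indexed by vectors or scalars that matter
    only up to a factor, so overlapping members need only coincide as sets. *)
Lemma partition_imset (I T : finType) (F : I -> {set T}) (D : {set I})
    (G : {set T}) :
  (forall i, i \in D -> F i != set0) ->
  (forall i j x, i \in D -> j \in D -> x \in F i -> x \in F j -> F i = F j) ->
  cover [set F i | i in D] = G -> partition [set F i | i in D] G.
Proof.
move=> F0 FI coverG; apply/and3P; split; first exact/eqP.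
  apply/trivIsetP=> _ _ /imsetP[i iD ->] /imsetP[j jD ->]; apply: contraR.
  rewrite -setI_eq0 => /set0Pn[x /setIP[xi xj]].
  exact/eqP/(FI _ _ x).
by apply/imsetP=> -[i /F0]; rewrite eq_sym => /eqP.
Qed.

Variables (K : fieldType) (vT : vectType K).

Lemma span_ind (X : seq vT) (T : vT -> Prop) :
  T 0 -> (forall A B, T A -> T B -> T (A + B)) ->
  (forall c A, T A -> T (c *: A)) ->
  (forall A, A \in X -> T A) ->
  forall A, A \in <<X>>%VS -> T A.
Proof.
move=> T0 TD TZ; elim: X => [|B X IH] TX A.
  by rewrite span_nil memv0 => /eqP->.
rewrite span_cons => /memv_addP[_ /vlineP[c ->] [C XC ->]].
apply: TD; first by apply/TZ/TX; rewrite mem_head.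
by apply: IH XC => D XD; apply: TX; rewrite inE XD orbT.
Qed.

Lemma span_imageP (I : eqType) (e : I -> vT) (r : seq I) A : uniq r ->
  A \in <<[seq e i | i <- r]>>%VS ->
  exists c : I -> K, A = \sum_(i <- r) c i *: e i.
Proof.
elim: r A => [|i r IH] A /=.
  by move=> _; rewrite span_nil memv0 => /eqP ->; exists (fun=> 0);
    rewrite big_nil.
case/andP=> i_r Ur; rewrite span_cons.
case/memv_addP=> _ /vlineP[a ->] [B /(IH _ Ur)[c ->] ->].
exists (fun j => if j == i then a else c j); rewrite big_cons eqxx.
congr (_ + _); apply: eq_big_seq => j jr.
by case: eqP => // eq_ji; rewrite -eq_ji jr in i_r.
Qed.

Lemma free_image_inj (I : eqType) (e : I -> vT) (r : seq I) (c : I -> K) :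
  uniq r -> free [seq e i | i <- r] -> \sum_(i <- r) c i *: e i = 0 ->
  forall i, i \in r -> c i = 0.
Proof.
elim: r => [|i r IH] //= /andP[i_r Ur]; rewrite free_cons big_cons.
case/andP=> i_free r_free sum0.
have sum_r : \sum_(j <- r) c j *: e j \in <<[seq e j | j <- r]>>%VS.
  rewrite big_seq; apply: memv_suml => j jr; apply: memvZ; apply: memv_span.
  exact: map_f.
have ci0 : c i = 0.
  apply/eqP/negPn/negP=> ci0; case/negP: i_free.
  rewrite -[e i](scalerK ci0) memvZ //.
  by move/eqP: sum0; rewrite addr_eq0 => /eqP ->; rewrite memvN.
move=> j; rewrite inE => /predU1P[-> //|]; apply: IH => //.
by move: sum0; rewrite ci0 scale0r add0r.
Qed.

End Prerequisites.

(** * Points as sets of matrices, and their joins *)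

Section Points.

Set Implicit Arguments.
Unset Strict Implicit.
Unset Printing Implicit Defensive.

Import GRing.Theory.
Local Open Scope ring_scope.

Variables (L : finFieldType) (h k : nat).
Local Notation V := 'M[L]_(h, k).
Implicit Types (A B : V) (S : {set {set V}}) (P : {set V}).

Lemma mem_pt A B : (B \in pt A) = (B \in <[A]>%VS).
Proof. by rewrite inE. Qed.

Lemma ptP A B : reflect (exists c, B = c *: A) (B \in pt A).
Proof. by rewrite mem_pt; apply: vlineP. Qed.

Lemma pt_id A : A \in pt A.
Proof. by rewrite mem_pt memv_line. Qed.

Lemma pt_eq A B : pt A = pt B -> exists c, A = c *: B.
Proof. by move=> eqAB; apply/ptP; rewrite -eqAB pt_id. Qed.

Lemma ptZ c A : c != 0 -> pt (c *: A) = pt A.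
Proof.
move=> c0; apply/setP=> B; apply/ptP/ptP=> -[d ->].
  by exists (d * c); rewrite scalerA.
by exists (d / c); rewrite scalerA divfK.
Qed.

Lemma PGP P : reflect (exists2 A, A != 0 & P = pt A) (P \in PG L h k).
Proof.
apply: (iffP imsetP) => -[A A0 ->]; exists A => //.
  by rewrite !inE in A0.
by rewrite !inE.
Qed.

Lemma mem_lspan S P A : P \in S -> A \in P -> A \in lspan S.
Proof.
by move=> PS AP; apply: memv_span; rewrite mem_enum; apply/bigcupP; exists P.
Qed.

Lemma lspan_sub S (U : {vspace V}) :
  (forall P A, P \in S -> A \in P -> A \in U) -> (lspan S <= U)%VS.
Proof.
move=> SU; apply/span_subvP=> A; rewrite mem_enum => /bigcupP[P PS AP].
exact: SU PS AP.
Qed.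

Lemma mem_join_pt S A : A != 0 -> (pt A \in join S) = (A \in lspan S).
Proof.
move=> A0; rewrite inE.
have -> : pt A \in PG L h k by apply/PGP; exists A.
apply/subsetP/idP => [/(_ A (pt_id A)) // | AS B /ptP[c ->]].
exact: memvZ.
Qed.

(** Allows a spread element, first seen as a subspace of [Pi], to be seen as a subspace of the space
    it helps to partition. *)
Lemma subspace_of_sub (Sigma S S' : {set {set V}}) d :
  subspace_of Sigma d S -> S \subset S' -> S' \subset Sigma ->
  subspace_of S' d S.
Proof.
case/andP=> /eqP defS dimS SS' S'Sigma; rewrite /subspace_of dimS andbT.
rewrite eqEsubset subsetI SS' /=; apply/andP; split;
  first by rewrite {1}defS subsetIr.
by rewrite {2}defS setSI.
Qed.

End Points.

Section GeneralizedSegre.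

Set Implicit Arguments.
Unset Strict Implicit.
Unset Printing Implicit Defensive.

Import GRing.Theory.
Local Open Scope ring_scope.

Variables (p n q h k : nat) (L : finFieldType).
Hypotheses (p_prime : prime p) (q_def : q = (p ^ n)%N) (q_gt1 : (1 < q)%N).
Hypotheses (h_gt0 : (0 < h)%N) (card_L : #|L| = (q ^ h)%N).

Local Notation Fq := (@Fq q L).

(** * Frobenius powers and the subfields of [L] *)

Lemma FqP s (x : L) : reflect (x ^+ (q ^ s) = x) (x \in Fq s).
Proof. by rewrite inE; apply: eqP. Qed.

Lemma frobD s (x y : L) :
  (x + y) ^+ (q ^ s) = x ^+ (q ^ s) + y ^+ (q ^ s).
Proof.
have pL : p \in [pchar L].
  by apply: (@card_finPcharP _ p (n * h)); rewrite // expnM -q_def.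
rewrite q_def -expnM exprDn_pchar // pnatX; apply/orP; left.
by rewrite pnatE.
Qed.

Lemma frob0 s : (0 : L) ^+ (q ^ s) = 0.
Proof. by rewrite expr0n expn_eq0 -leqn0 leqNgt (ltnW q_gt1). Qed.

Lemma frobN s (x : L) : (- x) ^+ (q ^ s) = - x ^+ (q ^ s).
Proof. by apply/eqP; rewrite -addr_eq0 -frobD addNr frob0. Qed.

Lemma frob_comp s s' (x : L) : (x ^+ (q ^ s)) ^+ (q ^ s') = x ^+ (q ^ (s + s')).
Proof. by rewrite -exprM -expnD. Qed.

Lemma frob_h (x : L) : x ^+ (q ^ h) = x.
Proof. by rewrite -card_L expf_card. Qed.

Lemma Fq_dvd s s' : (s %| s')%N -> {subset Fq s <= Fq s'}.
Proof.
move=> /dvdnP[m ->] x /FqP xs; apply/FqP.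
by elim: m => [|m IH]; rewrite ?expr1 // mulSn -frob_comp xs.
Qed.

(** Exponents of the Frobenius map count modulo h, just like the row indices shifted cyclically by
    [psi_mx]; this absorbs every wrap-around below. *)
Lemma frob_mod a b (x : L) :
  a = b %[mod h] -> x ^+ (q ^ a) = x ^+ (q ^ b).
Proof.
have red c : x ^+ (q ^ c) = x ^+ (q ^ (c %% h)).
  rewrite {1}(divn_eq c h) addnC -frob_comp; apply/FqP.
  by apply: (@Fq_dvd h); [rewrite dvdn_mull | apply/FqP/frob_h].
by move=> eq_ab; rewrite (red a) (red b) eq_ab.
Qed.

Lemma frob_inj s : injective (fun x : L => x ^+ (q ^ s)).
Proof.
move=> x y /eqP; rewrite -subr_eq0 -frobN -frobD expf_eq0 subr_eq0.
by case/andP=> _ /eqP.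
Qed.

Lemma frob_surj s (x : L) : exists y : L, y ^+ (q ^ s) = x.
Proof.
have [g _ gK] := injF_bij (@frob_inj s).
by exists (g x).
Qed.

Lemma Fq0 s : 0 \in Fq s.
Proof. exact/FqP/frob0. Qed.

Lemma Fq1 s : 1 \in Fq s.
Proof. exact/FqP/expr1n. Qed.

Lemma FqD s x y : x \in Fq s -> y \in Fq s -> x + y \in Fq s.
Proof. by move=> /FqP xs /FqP ys; apply/FqP; rewrite frobD xs ys. Qed.

Lemma FqN s x : x \in Fq s -> - x \in Fq s.
Proof. by move=> /FqP xs; apply/FqP; rewrite frobN xs. Qed.

Lemma FqM s x y : x \in Fq s -> y \in Fq s -> x * y \in Fq s.
Proof. by move=> /FqP xs /FqP ys; apply/FqP; rewrite exprMn xs ys. Qed.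

Lemma FqV s x : x \in Fq s -> x^-1 \in Fq s.
Proof. by move=> /FqP xs; apply/FqP; rewrite exprVn xs. Qed.

Lemma Fq_sum s (I : Type) (r : seq I) (P : pred I) (F : I -> L) :
  (forall i, P i -> F i \in Fq s) -> \sum_(i <- r | P i) F i \in Fq s.
Proof. by move=> FF; elim/big_ind: _ => //; [apply: Fq0 | apply: FqD]. Qed.

Lemma FqMr s x y : x != 0 -> x \in Fq s -> x * y \in Fq s -> y \in Fq s.
Proof.
by move=> x0 xs xys; rewrite -(mulKf x0 y) FqM // FqV.
Qed.

Lemma Fq_mulmx s a b c (A : 'M[L]_(a, b)) (B : 'M[L]_(b, c)) :
  A \is a mxOver (Fq s) -> B \is a mxOver (Fq s) -> A *m B \is a mxOver (Fq s).
Proof.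
move=> /mxOverP As /mxOverP Bs; apply/mxOverP=> i j.
by rewrite mxE Fq_sum // => l _; rewrite FqM.
Qed.

Lemma Fq_scalemx s a b x (A : 'M[L]_(a, b)) :
  x \in Fq s -> A \is a mxOver (Fq s) -> x *: A \is a mxOver (Fq s).
Proof.
by move=> xs /mxOverP As; apply/mxOverP=> i j; rewrite mxE FqM.
Qed.

Lemma Fq_scalemxr s a b x (A : 'M[L]_(a, b)) :
  A != 0 -> A \is a mxOver (Fq s) -> x *: A \is a mxOver (Fq s) -> x \in Fq s.
Proof.
case/matrix0Pn=> i [j nz] /mxOverP As /mxOverP /(_ i j).
by rewrite mxE mulrC; apply: FqMr.
Qed.

(** X^(q^s) - X divides X^(q^h) - X, the product of all X - x with x in [L]; hence it splits with
    distinct roots, and their number is its degree. *)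
Lemma card_Fq s : (0 < s)%N -> (s %| h)%N -> #|Fq s| = (q ^ s)%N.
Proof.
move=> s_gt0 /dvdnP[m h_eq].
have qs_gt1 : (1 < q ^ s)%N by rewrite -(expn0 q) ltn_exp2l.
have sz : size ('X^(q ^ s) - 'X : {poly L}) = (q ^ s).+1.
  by rewrite size_polyDl ?size_polyXn // size_polyN size_polyX ltnS.
have XE N : (0 < N)%N -> 'X^N - 'X = 'X * ('X^(N.-1) - 1) :> {poly L}.
  by move=> N_gt0; rewrite mulrBr mulr1 -exprS prednK.
have dv : 'X^(q ^ s) - 'X %| \prod_(x : L) ('X - x%:P).
  rewrite -finField_genPoly card_L h_eq mulnC expnM !XE ?expn_gt0 ?(ltnW q_gt1)
    //.
  rewrite dvdp_mul2l ?polyX_eq0 //.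
  (* With the factor X cancelled, divisibility follows from that of (q^s)^m - 1 by q^s - 1. *)
  case/dvdnP: (dvdn_pred_predX (q ^ s) m) => c ->.
  by rewrite mulnC exprM (subrX1 ('X^_) c) dvdp_mulr.
have [msk Em] := dvdp_prod_XsubC dv.
set rs := mask msk (index_enum L) in Em.
have Urs : uniq rs by rewrite mask_uniq // index_enum_uniq.
have szrs : size rs = (q ^ s)%N.
  by apply/eq_add_S; rewrite -(size_prod_XsubC rs id) -(eqp_size Em).
rewrite -szrs -(card_uniqP Urs); apply: eq_card => x.
rewrite -(root_prod_XsubC rs) -(eqp_root Em) rootE !hornerE.
by rewrite subr_eq0 inE.
Qed.

(** Greedy choice by counting: m independent elements have (q^s)^m combinations, so for m < t some
    element of F_{q^(st)} is missed and can be added; for m = t the combinations exhaust the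
    field. *)
Lemma Fq_basis s t : (0 < s)%N -> (0 < t)%N -> (s * t %| h)%N ->
  exists b : 'cV[L]_t, [/\ b \is a mxOver (Fq (s * t)),
    forall z : 'rV_t, z \is a mxOver (Fq s) -> z *m b = 0 -> z = 0 &
    forall a, a \in Fq (s * t) ->
      exists2 z : 'rV_t, z \is a mxOver (Fq s) & z *m b = a%:M].
Proof.
move=> s_gt0 t_gt0 st_h.
have s_h : (s %| h)%N by apply: dvdn_trans st_h; apply: dvdn_mulr.
have qs_gt1 : (1 < q ^ s)%N by rewrite -(expn0 q) ltn_exp2l.
pose val m (b : 'I_m -> L) (z : {ffun 'I_m -> L}) := \sum_i z i * b i.
pose lin m (b : 'I_m -> L) := forall z : {ffun 'I_m -> L},
  z \in ffun_on (Fq s) -> val m b z = 0 -> forall i, z i = 0.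
pose img m b : {set L} := [set val m b z | z in ffun_on (Fq s)].
have imgF m b : (forall i, b i \in Fq (s * t)) ->
    img m b \subset [set x in Fq (s * t)].
  move=> bF; apply/subsetP=> x /imsetP[z /ffun_onP zF ->]; rewrite inE.
  rewrite Fq_sum // => i _; rewrite FqM //.
  by apply: (Fq_dvd (dvdn_mulr t (dvdnn s))).
have card_img m b : lin m b -> #|img m b| = ((q ^ s) ^ m)%N.
  move=> lin_b; rewrite card_in_imset ?card_ffun_on ?card_ord ?card_Fq //.
  move=> y z /ffun_onP yF /ffun_onP zF eq_yz.
  apply/ffunP=> i; apply/eqP; rewrite -subr_eq0; apply/eqP.
  have := lin_b [ffun i => y i - z i]; rewrite /val.
  move/(_ _ _ i); rewrite ffunE; apply.
    by apply/ffun_onP=> j; rewrite ffunE FqD ?FqN.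
  rewrite (eq_bigr (fun i => y i * b i - z i * b i)).
    by rewrite sumrB -/(val m b y) eq_yz subrr.
  by move=> j _; rewrite ffunE mulrBl.
have card_st : #|[set x in Fq (s * t)]| = ((q ^ s) ^ t)%N.
  by rewrite cardsE card_Fq ?muln_gt0 ?s_gt0 // expnM.
have greedy m : (m <= t)%N -> exists b : 'I_m -> L,
    (forall i, b i \in Fq (s * t)) /\ lin m b.
  elim: m => [|m IH] le_mt.
    by exists (fun _ => 0); split=> [[]|z _ _ []].
  have [b [bF lin_b]] := IH (ltnW le_mt).
  have [c cF cN] : exists2 c, c \in Fq (s * t) & c \notin img m b.
    have: img m b \proper [set x in Fq (s * t)].
      by rewrite properEcard imgF // card_img // card_st ltn_exp2l.
    by case/properP=> _ [c]; rewrite inE; exists c.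
  exists (fun i => oapp b c (unlift ord0 i)); split=> [i|z /ffun_onP zF].
    by case: unliftP => [j|] _ /=.
  rewrite /val big_ord_recl unlift_none /=.
  under eq_bigr do rewrite liftK /=.
  move=> z0.
  (* A nonzero coefficient of the new element [c] could be divided out, putting [c] among the
     combinations of [b]. *)
  have z00 : z ord0 = 0.
    apply/eqP/negPn/negP=> nz; case/negP: cN.
    apply/imsetP; exists [ffun i => - (z ord0)^-1 * z (lift ord0 i)].
      by apply/ffun_onP=> i; rewrite ffunE FqM ?FqN ?FqV.
    rewrite /val; under eq_bigr do rewrite ffunE -mulrA.
    rewrite -mulr_sumr; move/eqP: z0; rewrite addrC addr_eq0 => /eqP ->.
    by rewrite mulrNN mulKf.
  move=> i; case: (unliftP ord0 i) => [j ->|-> //].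
  have := lin_b [ffun i => z (lift ord0 i)].
  move/(_ _ _ j); rewrite ffunE; apply.
    by apply/ffun_onP=> l; rewrite ffunE.
  rewrite /val; under eq_bigr do rewrite ffunE.
  by move: z0; rewrite z00 mul0r add0r.
have [b [bF lin_b]] := greedy t (leqnn t).
exists (\col_i b i); split.
- by apply/mxOverP=> i j; rewrite mxE.
- move=> z /mxOverP zF zb0; apply/rowP=> i; rewrite mxE.
  have := lin_b [ffun i => z 0 i]; move/(_ _ _ i); rewrite ffunE; apply.
    by apply/ffun_onP=> l; rewrite ffunE.
  have /matrixP/(_ 0 0) := zb0; rewrite !mxE => <-.
  by apply: eq_bigr => j _; rewrite ffunE mxE.
- move=> a aF.
  have /eqP eq_img : img t b == [set x in Fq (s * t)].
    by rewrite eqEcard imgF // card_img // card_st leqnn.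
  have: a \in img t b by rewrite eq_img inE.
  case/imsetP=> z /ffun_onP zF ->; exists (\row_i z i).
    by apply/mxOverP=> i j; rewrite mxE.
  apply/matrixP=> i j; rewrite !ord1 !mxE eqxx mulr1n.
  by apply: eq_bigr => l _; rewrite !mxE.
Qed.

(** * The semilinear map [psi_mx] and the vectors fixed by its powers *)

Local Notation V := 'M[L]_(h, k).
Local Notation psi_mx := (@psi_mx q L h k).
Local Notation phi s := (iter s psi_mx).
Local Notation pt := (@pt L h k).

Lemma phiE s (A : V) i j : phi s A i j =
  (A (iter s (@ord_pred h) i) j) ^+ (q ^ s).
Proof.
elim: s i => [|s IH] i; first by rewrite expr1.
by rewrite iterS mxE IH -iterSr expnSr exprM.
Qed.

(** The additive congruence avoids truncated subtraction. *)
Lemma iter_ord_pred s (i : 'I_h) : (iter s (@ord_pred h) i + s = i %[mod h])%N.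
Proof.
elim: s => [|s IH]; first by rewrite addn0.
rewrite iterS /= modnDml addnS -addSn prednK ?addn_gt0 ?h_gt0 ?orbT //.
by rewrite addnAC modnDr.
Qed.

Lemma phi_order (A : V) : phi h A = A.
Proof.
apply/matrixP=> i j; rewrite phiE frob_h; congr (A _ j).
apply/val_inj; have := iter_ord_pred h i.
by rewrite modnDr !modn_small.
Qed.

Lemma phiD s (A B : V) : phi s (A + B) = phi s A + phi s B.
Proof. by apply/matrixP=> i j; rewrite mxE !phiE mxE frobD. Qed.

Lemma phi0 s : phi s 0 = 0 :> V.
Proof. by apply/matrixP=> i j; rewrite phiE !mxE frob0. Qed.

Lemma phiZ s c (A : V) : phi s (c *: A) = c ^+ (q ^ s) *: phi s A.
Proof. by apply/matrixP=> i j; rewrite mxE !phiE mxE exprMn. Qed.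

Lemma phi_sum s (I : Type) (r : seq I) (P : pred I) (F : I -> V) :
  phi s (\sum_(i <- r | P i) F i) = \sum_(i <- r | P i) phi s (F i).
Proof. exact: (big_morph _ (@phiD s) (phi0 s)). Qed.

Lemma phi_mul s m (A : V) : phi (s * m) A = iter m (phi s) A.
Proof. by elim: m => [|m IH]; rewrite ?muln0 // mulnS iterD IH. Qed.

Lemma phi_fix_mul s m (A : V) : phi s A = A -> phi (s * m) A = A.
Proof. by move=> As; rewrite phi_mul; elim: m => //= m ->. Qed.

Lemma phi_fix_dvd s s' (A : V) : (s %| s')%N -> phi s A = A -> phi s' A = A.
Proof. by case/dvdnP=> m ->; rewrite mulnC; apply: phi_fix_mul. Qed.

Lemma iter_psi_pt s (A : V) : iter s (@psi q L h k) (pt A) = pt (phi s A).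
Proof.
elim: s => // s IH; rewrite !iterS IH /psi; set B := iter s _ A.
have psiZ c : psi_mx (c *: B) = c ^+ q *: psi_mx B by have := phiZ 1 c B.
apply/setP=> C; apply/imsetP/ptP=> [[_ /ptP[c ->] ->]|[c ->]].
  by exists (c ^+ q).
have [d dc] := frob_surj 1 c; exists (d *: B); first by apply/ptP; exists d.
by rewrite psiZ -[q in d ^+ q]expn1 dc.
Qed.

(* Hilbert 90: if psi^s fixes the point of A, summing the images of a A under the
   powers of psi^s gives a fixed multiple of A, nonzero unless a is a root of g,
   a polynomial of degree < q^h. *)
Lemma Pi_P s P : (0 < s)%N -> (s %| h)%N ->
  reflect (exists A, [/\ A != 0, phi s A = A & P = pt A]) (P \in Pi_ q L h k s).
Proof.
move=> s_gt0 s_h; rewrite inE.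
apply: (iffP andP) => [[/PGP[A A0 ->]]|[A [A0 As ->]]]; last first.
  by split; [apply/PGP; exists A | rewrite iter_psi_pt As].
rewrite iter_psi_pt => /eqP/pt_eq[c Ac].
have [t t_gt0 h_eq] : exists2 t, (0 < t)%N & h = (s * t)%N.
  case/dvdnP: s_h => t h_eq; exists t; last by rewrite mulnC.
  by move: h_gt0; rewrite h_eq muln_gt0 => /andP[].
have [d [d0 dA]] : exists d : nat -> L,
    d 0 = 1 /\ forall i, phi (s * i) A = d i *: A.
  exists (fix d i := if i is i'.+1 then d i' ^+ (q ^ s) * c else 1); split=> //.
  elim=> [|i IH]; first by rewrite muln0 scale1r.
  by rewrite mulnS iterD IH phiZ Ac scalerA.
pose g := \sum_(i < t) d i *: 'X^(q ^ (s * i)) : {poly L}.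
have g0 : g != 0.
  (* The coefficient of X is [d 0], that is 1, because all other exponents q^(s i) exceed 1. *)
  apply/eqP=> /polyP/(_ 1); rewrite coef_sum coef0.
  case: t t_gt0 {g h_eq} => // t _.
  rewrite big_ord_recl big1 => [|i _]; rewrite coefZ coefXn.
    by rewrite muln0 eqxx d0 mulr1 addr0; apply/eqP/oner_neq0.
  rewrite ltn_eqF ?mulr0 //= -[X in (X < _)%N](expn0 q) ltn_exp2l //.
  by rewrite muln_gt0 s_gt0.
have szg : (size g <= q ^ h)%N.
  apply: (leq_trans (size_sum _ _ _)); apply/bigmax_leqP=> i _.
  apply: (leq_trans (size_scale_leq _ _)); rewrite size_polyXn.
  by rewrite ltn_exp2l // h_eq ltn_pmul2l.
have [a ga] : exists a, g.[a] != 0.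
  apply/existsP; rewrite -negb_forall; apply/negP=> /forallP g_eq0.
  have := @max_poly_roots _ _ (enum L) g0; rewrite enum_uniq -cardE card_L.
  rewrite ltnNge szg => /(_ _ isT) contra.
  by suff: false by []; apply: contra; apply/allP=> x _; apply: g_eq0.
have sumE : \sum_(i < t) phi (s * i) (a *: A) = g.[a] *: A.
  rewrite /g horner_sum scaler_suml; apply: eq_bigr => i _.
  by rewrite phiZ dA scalerA !hornerE mulrC.
exists (g.[a] *: A); split; first by rewrite scaler_eq0 negb_or ga A0.
  (* The map permutes the summands cyclically: the image of the last one is the first, since the
     power h of [psi_mx] is the identity. *)
  rewrite -sumE phi_sum; case: t t_gt0 {g g0 ga szg sumE} h_eq => // t _ h_eq.
  rewrite big_ord_recr big_ord_recl [RHS]addrC; congr (_ + _) => /=.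
    by apply: eq_bigr => i _; rewrite -iterD /= -mulnS.
  by rewrite -iterD -mulnS -h_eq phi_order muln0.
by rewrite ptZ.
Qed.

Section Coordinates.

Variables (s : nat) (I : finType) (e : I -> V).
Hypothesis e_fix : forall i, phi s (e i) = e i.

(** Subtracting the sum from its image leaves a relation with coefficients c_i^(q^s) - c_i, which
    vanish by independence. *)
Lemma fixed_coordinates (r : seq I) (c : I -> L) :
  uniq r -> free [seq e i | i <- r] ->
  phi s (\sum_(i <- r) c i *: e i) = \sum_(i <- r) c i *: e i ->
  forall i, i \in r -> c i \in Fq s.
Proof.
move=> Ur r_free sum_fix i ir; apply/FqP/eqP; rewrite -subr_eq0; apply/eqP.
apply: (@free_image_inj _ _ _ e r (fun i => c i ^+ (q ^ s) - c i)) => //.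
under eq_bigr do rewrite scalerBl.
rewrite sumrB -sum_fix phi_sum; apply/eqP; rewrite subr_eq0; apply/eqP.
by apply: eq_bigr => j _; rewrite phiZ e_fix.
Qed.

(* If e_i is an L-combination of independent phi-fixed e_j, applying phi shows,
   by uniqueness of the coefficients, that they lie in F_{q^s}. *)
Lemma fixed_free :
  (forall c : I -> L, (forall i, c i \in Fq s) ->
     \sum_i c i *: e i = 0 -> forall i, c i = 0) ->
  free [seq e i | i : I].
Proof.
move=> indep; rewrite /image_mem.
elim: (enum I) (enum_uniq I) => [|i r IH] /=; first by rewrite nil_free.
case/andP=> i_r Ur; rewrite free_cons IH // andbT.
apply/negP=> /(span_imageP Ur)[c ei].
have cF : forall j, j \in r -> c j \in Fq s.
  by apply: fixed_coordinates; rewrite ?IH // -ei.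
(* The relation obtained by moving the combination to the side of e_i; its coefficient 1 at i
   contradicts independence over F_{q^s}. *)
pose c' j := if j == i then 1 else if j \in r then - c j else 0.
have/(_ _ _ i) := indep c'; rewrite /c' eqxx => c'0.
suff /eqP: 1 = 0 :> L by rewrite oner_eq0.
apply: c'0 => [j|].
  case: ifP => _; first exact: Fq1.
  by case: ifP => [jr|_]; [apply: FqN; apply: cF | apply: Fq0].
rewrite (bigD1 i) //= eqxx scale1r {1}ei.
rewrite big_uniq //= [X in _ + X](bigID (mem r)) /= [X in _ + (_ + X)]big1.
  rewrite addr0 [X in _ + X](eq_bigl (fun j => j \in r)) => [|j]; last first.
    by case: eqP => [->|_] /=; [rewrite (negPf i_r) | ].
  rewrite -big_split big1 //= => j jr; rewrite jr.
  by case: eqP => [eq_ji|_]; [rewrite -eq_ji jr in i_r | rewrite scaleNr subrr].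
by move=> j /andP[/negPf-> /negPf->]; rewrite scale0r.
Qed.

End Coordinates.

(** * Sparse Moore matrices, representing the points of Theta_r *)

Definition sparse_moore r (w : 'rV[L]_k) : V :=
  \matrix_(i, j) if (r %| i)%N then w 0 j ^+ (q ^ i) else 0.

Local Notation smoore := sparse_moore.
Local Notation moore := (@moore q L h k).
Let i0 : 'I_h := Ordinal h_gt0.

Lemma mooreE w : moore w = smoore 1 w.
Proof. by apply/matrixP=> i j; rewrite !mxE dvd1n. Qed.

(** A cyclic shift by r preserves the row positions divisible by r because r divides h, and
    [frob_mod] matches the exponents. *)
Lemma sparse_moore_fix r w : (r %| h)%N -> phi r (smoore r w) = smoore r w.
Proof.
move=> r_h; apply/matrixP=> i j; rewrite phiE !mxE.
have Ei := iter_ord_pred r i; set i' := iter r _ i in Ei *.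
have -> : (r %| i')%N = (r %| i)%N.
  rewrite /dvdn -(modn_dvdm i r_h) -Ei (modn_dvdm _ r_h) modnDr //.
by case: ifP => _; rewrite ?frob0 // frob_comp (frob_mod _ Ei).
Qed.

Lemma sparse_mooreD r v w : smoore r (v + w) = smoore r v + smoore r w.
Proof.
apply/matrixP=> i j; rewrite !mxE; case: ifP => _; last by rewrite addr0.
exact: frobD.
Qed.

Lemma sparse_moore0 r : smoore r 0 = 0.
Proof.
by apply/matrixP=> i j; rewrite !mxE frob0 if_same.
Qed.

Lemma sparse_moore_sum r (I : Type) (s : seq I) (P : pred I) F :
  smoore r (\sum_(i <- s | P i) F i) = \sum_(i <- s | P i) smoore r (F i).
Proof. exact: (big_morph _ (sparse_mooreD r) (sparse_moore0 r)). Qed.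

Lemma sparse_mooreZ r a w : a \in Fq r -> smoore r (a *: w) = a *: smoore r w.
Proof.
move=> aF; apply/matrixP=> i j; rewrite !mxE; case: ifP => r_i;
  last by rewrite mulr0.
by rewrite exprMn; have /FqP-> := Fq_dvd r_i aF.
Qed.

Lemma sparse_moore_row0 r w j : smoore r w i0 j = w 0 j.
Proof. by rewrite mxE dvdn0 expr1. Qed.

Lemma sparse_moore_inj r : injective (smoore r).
Proof.
move=> v w /matrixP eq_vw; apply/rowP=> j.
by have := eq_vw i0 j; rewrite !sparse_moore_row0.
Qed.

Lemma sparse_moore_eq0 r w : (smoore r w == 0) = (w == 0).
Proof. by rewrite -(inj_eq (@sparse_moore_inj r)) sparse_moore0. Qed.

(** The multiples of rm, shifted by 0, r, ..., r(m-1), tile the multiples of r. With m = t this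
    places points of Theta_r in the join of the shifts of Theta; with r and m replaced by 1 and r it
    places Moore matrices in the span of a point of Theta_r and its conjugates. *)
Lemma sparse_moore_sum_phi r m w : (0 < r)%N -> (r * m %| h)%N ->
  smoore r w = \sum_(i < m) phi (r * i) (smoore (r * m) w).
Proof.
move=> r_gt0 rm_h; apply/matrixP=> s j; rewrite summxE.
have m_gt0 : (0 < m)%N.
  by rewrite lt0n; apply: contraTneq rm_h => ->; rewrite muln0 dvd0n gtn_eqF.
have term (i : 'I_m) : phi (r * i) (smoore (r * m) w) s j =
    if (r %| s)%N && (i == (s %/ r) %% m :> nat)%N then w 0 j ^+ (q ^ s) else 0.
  rewrite phiE mxE; have Es := iter_ord_pred (r * i) s.
  set s' := iter _ _ s in Es *.
  (* Row s is nonzero in the i-th term only if s is congruent to ri modulo rm, which determines i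
     from s. *)
  have -> : (r * m %| s')%N = (r %| s)%N && (i == (s %/ r) %% m :> nat)%N.
    rewrite /(_ %| s')%N -(mod0n (r * m)) -(eqn_modDr (r * i)) add0n.
    rewrite -(modn_dvdm _ rm_h) Es (modn_dvdm _ rm_h).
    have [/dvdnP[c ->]|] := boolP (r %| s)%N.
      rewrite mulnK // mulnC -!muln_modr eqn_pmul2l // eq_sym.
      by rewrite [X in X == _]modn_small.
    apply: contraNF =>
      /eqP Er; rewrite /dvdn -(modn_dvdm s (dvdn_mulr m (dvdnn r))).
    by rewrite Er -muln_modr modnMr.
  by case: ifP => _; rewrite ?frob0 // frob_comp (frob_mod _ Es).
rewrite (eq_bigr _ (fun i _ => term i)) mxE; case: ifP => _ /=;
  last by rewrite big1.
rewrite (bigD1 (Ordinal (ltn_pmod (s %/ r) m_gt0))) //= eqxx big1 ?addr0 //.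
by move=> i; rewrite -val_eqE /= => /negPf->.
Qed.

(** If r divides i, then [phi i] also fixes A and carries row 0 to row i, so row 0 determines every
    row in the support. *)
Lemma fixed_sparse_moore r A : (0 < r)%N ->
  phi r A = A -> (forall (i : 'I_h) j, ~~ (r %| i)%N -> A i j = 0) ->
  A = smoore r (row i0 A).
Proof.
move=> r_gt0 A_fix A_supp; apply/matrixP=> i j; rewrite !mxE.
case: ifPn => [r_i|]; last exact: A_supp.
rewrite -{1}(phi_fix_dvd r_i A_fix) phiE; congr (A _ j ^+ _).
apply/val_inj; have : (iter i (@ord_pred h) i + i == 0 + i %[mod h])%N by
  rewrite iter_ord_pred.
by rewrite eqn_modDr mod0n modn_small // => /eqP.
Qed.

Lemma PiP P : reflect (exists2 v, v != 0 & P = pt (moore v)) (P \in Pi q L h k).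
Proof.
apply: (iffP (Pi_P P (ltnSn 0) (dvd1n h))) => [[A [A0 A_fix ->]]|[v v0 ->]].
  exists (row i0 A); last by rewrite mooreE -fixed_sparse_moore // => i j;
    rewrite dvd1n.
  apply: contraNneq A0 => A0.
  by rewrite (fixed_sparse_moore (ltnSn 0) A_fix) ?A0 ?sparse_moore0 // =>
    i j; rewrite dvd1n.
exists (moore v); rewrite mooreE sparse_moore_eq0; split=> //.
exact: sparse_moore_fix.
Qed.

(** Both Moore matrices are fixed by [phi 1], so the scalar relating them equals its own q-th
    power. *)
Lemma pt_moore_eq u v : u != 0 -> pt (moore u) = pt (moore v) ->
  exists2 c, c \in Fq 1 & u = c *: v.
Proof.
rewrite !mooreE -(sparse_moore_eq0 1) => u0 /pt_eq[c Euv].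
have cF : c \in Fq 1.
  have Mv0 : smoore 1 v != 0 by apply: contraNneq u0 => v0;
    rewrite Euv v0 scaler0.
  have := congr1 (phi 1) Euv; rewrite phiZ !sparse_moore_fix ?dvd1n // Euv.
  move/eqP; rewrite -subr_eq0 -scalerBl scaler_eq0 (negPf Mv0) orbF subr_eq0.
  by move/eqP/esym/FqP.
exists c => //; apply: (@sparse_moore_inj 1); by rewrite sparse_mooreZ.
Qed.

(** * Projectivities and subspaces given by fixed families *)

Section FixedFrames.

Variables (s m d : nat) (e : 'I_m -> 'I_d -> V).
Hypotheses (s_gt0 : (0 < s)%N) (s_h : (s %| h)%N).
Hypothesis e_fix : forall i j, phi s (e i j) = e i j.

Let epair (ij : 'I_m * 'I_d) := e ij.1 ij.2.

Lemma combE x : comb e x = \sum_ij x ij.1 ij.2 *: epair ij.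
Proof. by rewrite /comb pair_bigA. Qed.

Lemma fixed_comb x : x \is a mxOver (Fq s) -> phi s (comb e x) = comb e x.
Proof.
move=> /mxOverP xF; rewrite combE phi_sum; apply: eq_bigr => ij _.
by rewrite phiZ e_fix; have /FqP-> := xF ij.1 ij.2.
Qed.

Lemma fixed_projectivity :
  (forall x, x \is a mxOver (Fq s) -> comb e x = 0 -> x = 0) ->
  projectivity q s e [set pt (comb e x) | x in nzmx q L s m d].
Proof.
move=> indep; rewrite /projectivity eqxx andbT.
apply: (@fixed_free s _ epair) => [ij|c cF c0 ij]; first exact: e_fix.
have /matrixP/(_ ij.1 ij.2) : \matrix_(i, j) c (i, j) = 0 :> 'M_(m, d).
  apply: indep; first by apply/mxOverP=> i j; rewrite mxE.
  by rewrite combE -[RHS]c0; apply: eq_bigr => -[i j] _; rewrite mxE.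
by rewrite !mxE; case: ij.
Qed.

(** The substantial inclusion: a point of Pi_s in the L-span of G has a fixed representative, whose
    coordinates then lie in F_{q^s} by [fixed_coordinates]. *)
Lemma projectivity_subspace G : (0 < m * d)%N -> projectivity q s e G ->
  subspace_of (Pi_ q L h k s) (m * d).-1 G.
Proof.
move=> mn_gt0 /andP[free_e /eqP defG].
have comb_neq0 x : x != 0 -> comb e x != 0.
  apply: contraNneq => x0; apply/eqP/matrixP=> i j; rewrite mxE.
  have := @free_image_inj _ _ _ epair (enum {: 'I_m * 'I_d}) (fun ij =>
    x ij.1 ij.2).
  move=> /(_ (enum_uniq _) free_e) inj; apply: (inj _ (i, j));
    last exact: mem_enum.
  by rewrite big_enum -combE x0.
have defspan : lspan G = <<[seq epair ij | ij : 'I_m * 'I_d]>>%VS.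
  apply/eqP; rewrite eqEsubv; apply/andP; split.
    apply: lspan_sub => P A; rewrite defG => /imsetP[x xF ->] /ptP[c ->].
    apply: memvZ; rewrite combE; apply: memv_suml => ij _; apply: memvZ.
    by apply: memv_span; apply: map_f; apply: mem_enum.
  apply/span_subvP=> _ /mapP[ij _ ->].
  apply: (@mem_lspan _ _ _ _ (pt (epair ij))); last exact: pt_id.
  rewrite defG; apply/imsetP; exists (delta_mx ij.1 ij.2).
    rewrite inE; apply/andP; split.
      by apply/matrix0Pn; exists ij.1, ij.2; rewrite mxE !eqxx oner_eq0.
    by apply/mxOverP=> i j; rewrite mxE; case: (_ && _); rewrite ?Fq0 ?Fq1.
  congr pt; rewrite combE (bigD1 ij) //= mxE !eqxx scale1r big1 ?addr0 //.
  case: ij => i j [i' j']; rewrite mxE /= xpair_eqE => /negPf->.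
  by rewrite scale0r.
apply/andP; split; last first.
  rewrite defspan; move: free_e; rewrite /free => /eqP->.
  by rewrite size_map -cardE card_prod !card_ord prednK.
rewrite eqEsubset; apply/andP; split; apply/subsetP=> P.
  rewrite defG => /imsetP[x]; rewrite inE => /andP[x0 xF] ->.
  rewrite in_setI mem_join_pt ?comb_neq0 //; apply/andP; split.
    by apply/(Pi_P _ s_gt0 s_h); exists (comb e x);
      rewrite comb_neq0 ?fixed_comb.
  rewrite -defG; apply: (mem_lspan _ (pt_id _)); rewrite defG.
  by apply: imset_f; rewrite inE x0.
rewrite in_setI => /andP[/(Pi_P _ s_gt0 s_h)[A [A0 A_fix ->]]].
rewrite mem_join_pt // defspan /image_mem => A_span.
have [c defA] := span_imageP (enum_uniq _) A_span.
have cF ij : c ij \in Fq s.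
  apply: (@fixed_coordinates s _ epair _ (enum {: 'I_m * 'I_d}) c (enum_uniq _)
    free_e).
  - by move=> ij'; apply: e_fix.
  - by rewrite -defA.
  - exact: mem_enum.
pose x : 'M[L]_(m, d) := \matrix_(i, j) c (i, j).
have defAx : A = comb e x.
  by rewrite combE defA big_enum; apply: eq_bigr => -[i j] _; rewrite mxE.
rewrite defG defAx; apply: imset_f; rewrite inE; apply/andP; split.
  apply: contraNneq A0 => x0; rewrite defAx x0 /comb big1 // => i _.
  by rewrite big1 // => j _; rewrite mxE scale0r.
by apply/mxOverP=> i j; rewrite mxE.
Qed.

End FixedFrames.

(** * The space Theta_r and the elements of its spread *)

Section SubfieldSpread.

Variables r t : nat.
Hypotheses (r_gt0 : (0 < r)%N) (t_gt0 : (0 < t)%N) (h_def : h = (r * t)%N).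

Let r_h : (r %| h)%N.
Proof. by rewrite h_def dvdn_mulr. Qed.

Lemma Theta_E :
  Theta_ q L h k r t = [set pt (smoore r w) | w in [set~ 0]].
Proof.
apply/setP=> P; rewrite in_setI;
  apply/andP/imsetP=> [[/(Pi_P P r_gt0 r_h)]|[w]].
  case=> A [A0 A_fix ->]; rewrite mem_join_pt // => A_span.
  (* Each shift of Theta by a multiple of r is supported on one row, at a position divisible by r;
     this support condition passes to the span. *)
  have defA : A = smoore r (row i0 A).
    apply: fixed_sparse_moore => // i j r_i.
    move: A A_span {A0 A_fix}; apply: span_ind.
    - by rewrite mxE.
    - by move=> A B; rewrite mxE => -> ->; rewrite addr0.
    - by move=> c A; rewrite mxE => ->; rewrite mulr0.
    move=> A; rewrite mem_enum => /bigcupP[_ /bigcupP[m _ /imsetP[P' P'T ->]]].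
    move: P'T; rewrite inE => /andP[/PGP[B B0 ->] /forallP/(_ B)].
    rewrite pt_id iter_psi_pt => /forallP B_supp /ptP[c ->].
    rewrite mxE phiE; set i' := iter _ _ i.
    have i'_neq0 : i' != 0 :> nat.
      apply: contraNneq r_i => i'0; have := iter_ord_pred (r * m) i.
      rewrite -/i' i'0 add0n /dvdn => eq_mi.
      by rewrite -(modn_dvdm i r_h) -eq_mi modn_dvdm // modnMr.
    have /forallP/(_ j)/implyP/(_ i'_neq0)/eqP-> := B_supp i'.
    by rewrite frob0 mulr0.
  exists (row i0 A); last by rewrite -defA.
  by rewrite !inE; apply: contraNneq A0 => A0; rewrite defA A0 sparse_moore0.
rewrite in_setC1 => w0 ->; split.
  apply/(Pi_P _ r_gt0 r_h); exists (smoore r w).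
  by rewrite sparse_moore_eq0 sparse_moore_fix.
rewrite mem_join_pt ?sparse_moore_eq0 //.
(* Since rt = h, the summands are shifts of [smoore h w], whose only possibly nonzero row is the
   first: a matrix of Theta. *)
rewrite (@sparse_moore_sum_phi r t) -?h_def //; apply: memv_suml => i _.
apply: (mem_lspan _ (pt_id _)); apply/bigcupP; exists i => //.
apply/imsetP; exists (pt (smoore h w)); last by rewrite iter_psi_pt.
rewrite inE; apply/andP; split.
  by apply/PGP; exists (smoore h w); rewrite ?sparse_moore_eq0.
apply/forallP=> A; apply/implyP=> /ptP[c ->].
apply/forallP=> s; apply/forallP=> j; apply/implyP=> s0.
by rewrite !mxE gtnNdvd ?mulr0 // lt0n.
Qed.

Definition Fq_units : {set L} := [set a | (a != 0) && (a \in Fq r)].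

Lemma Fq_unitsP a : reflect (a != 0 /\ a \in Fq r) (a \in Fq_units).
Proof. by rewrite in_set; apply: andP. Qed.

(* The element of the spread D_r through the point M_v of Pi, for v != 0. *)
Definition spread_at (v : 'rV[L]_k) : {set {set V}} :=
  [set pt (moore (a *: v)) | a in Fq_units].

(** A Moore matrix M_u in the span of the conjugates is compared with v in rows 0 and r: row 0 gives
    u = cv, and row r forces c into F_{q^r}. *)
Lemma spread_elt_smoore v : (r < h)%N -> v != 0 ->
  spread_elt q r (pt (smoore r v)) = spread_at v.
Proof.
move=> r_lt_h v0; pose X (i : 'I_r) := phi i (smoore r v).
have defS : [set iter i (@psi q L h k) (pt (smoore r v)) | i : 'I_r] =
    [set pt (X i) | i : 'I_r].
  by apply: eq_imset => i; rewrite iter_psi_pt.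
rewrite /spread_elt defS; apply/setP=> P; rewrite 2!in_setI.
apply/andP/imsetP=> [[/andP[_ PX] /PiP[u u0 defP]]|[a /Fq_unitsP[a0 aF] ->]].
  have : moore u \in <<[seq X i | i <- enum 'I_r]>>%VS.
    move: PX; rewrite defP mem_join_pt ?mooreE ?sparse_moore_eq0 //.
    apply: subvP; apply: lspan_sub => _ A /imsetP[i _ ->] /ptP[c ->].
    by apply/memvZ/memv_span/map_f; rewrite mem_enum.
  case/(span_imageP (enum_uniq _)) => c; rewrite big_enum /= => def_u.
  pose j0 := Ordinal r_gt0.
  (* In rows divisible by r only the unshifted conjugate, i = 0, contributes. *)
  have row_u (s : 'I_h) j : (r %| s)%N ->
      u 0 j ^+ (q ^ s) = c j0 * v 0 j ^+ (q ^ s).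
    move=> r_s; have /matrixP/(_ s j) := def_u; rewrite mxE => ->.
    rewrite summxE (bigD1 j0) //= big1 ?addr0 => [|i i_neq0].
      by rewrite !mxE r_s.
    rewrite mxE /X phiE mxE; set s' := iter i _ s.
    have -> : (r %| s')%N = false.
      apply: contraNF i_neq0 => r_s';
        rewrite -val_eqE /= -(modn_small (ltn_ord i)).
      have := iter_ord_pred i s; rewrite -/s' => /(congr1 (modn^~ r)).
      rewrite !(modn_dvdm _ r_h) (eqP r_s) -modnDml (eqP r_s') add0n => ->.
      exact: eqxx.
    by rewrite frob0 mulr0.
  have defu : u = c j0 *: v.
    by apply/rowP=> j; have := row_u i0 j (dvdn0 r); rewrite !expr1 mxE.
  exists (c j0); last by rewrite defP defu.
  have c0 : c j0 != 0 by apply: contraNneq u0 => c0; rewrite defu c0 scale0r.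
  apply/Fq_unitsP; split=> //; apply/FqP.
  have [i [j vj0]] := matrix0Pn _ v0; rewrite ord1 in vj0.
  (* Row r exists because r < h; cancelling v_j^(q^r) gives c^(q^r) = c. *)
  have := row_u (Ordinal r_lt_h) j (dvdnn r).
  rewrite defu mxE exprMn => /mulIf; apply; exact: expf_neq0.
have av0 : a *: v != 0 by rewrite scaler_eq0 negb_or a0.
split; last by apply/PiP; exists (a *: v).
rewrite mooreE; apply/andP; split.
  apply/(Pi_P _ r_gt0 r_h); exists (smoore 1 (a *: v)).
  rewrite sparse_moore_eq0; split=> //.
  by apply: (phi_fix_dvd (dvd1n r)); apply: sparse_moore_fix.
rewrite mem_join_pt ?sparse_moore_eq0 // (@sparse_moore_sum_phi 1 r) ?mul1n //.
apply: memv_suml => i _; rewrite mul1n sparse_mooreZ // phiZ; apply: memvZ.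
by apply: (mem_lspan _ (pt_id _)); apply: imset_f.
Qed.

Lemma mem_nzmx s a b (x : 'M[L]_(a, b)) :
  reflect (x != 0 /\ x \is a mxOver (Fq s)) (x \in nzmx q L s a b).
Proof. by rewrite in_set; apply: andP. Qed.

Lemma Fq_basis_mx s d : (0 < s)%N -> (0 < d)%N -> (s * d %| h)%N ->
  exists b : 'cV[L]_d, [/\ b \is a mxOver (Fq (s * d)),
    forall m (z : 'M_(m, d)), z \is a mxOver (Fq s) -> z *m b = 0 -> z = 0 &
    forall m (w : 'cV_m), w \is a mxOver (Fq (s * d)) ->
      exists2 z : 'M_(m, d), z \is a mxOver (Fq s) & z *m b = w].
Proof.
move=> s_gt0 d_gt0 sd_h; have [b [bF inj surj]] := Fq_basis s_gt0 d_gt0 sd_h.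
exists b; split=> // [m z zF zb0|m w /mxOverP wF].
  apply/row_matrixP=> i; rewrite row0; apply: inj.
    by apply/mxOverP=> i' j; rewrite mxE; apply: (mxOverP zF).
  by rewrite -row_mul zb0 row0.
have /fin_all_exists2[z zF zb] i := surj (w i 0) (wF i 0).
exists (\matrix_i z i).
  by apply/mxOverP=> i j; rewrite mxE; apply: (mxOverP (zF i)).
apply/row_matrixP=> i; rewrite row_mul rowK zb.
by apply/matrixP=> i' j; rewrite !ord1 !mxE eqxx mulr1n.
Qed.

(** * Subspaces of [Pi] spanned over F_{q^r} by a family of vectors *)

Section Frame.

Variables (m : nat) (f : 'I_m -> 'rV[L]_k).

Definition lcomb (w : 'cV[L]_m) : 'rV[L]_k := \sum_j w j 0 *: f j.

Definition frame_space : {set {set V}} :=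
  [set pt (moore (lcomb w)) | w in nzmx q L r m 1].

Lemma lcombZ a w : lcomb (a *: w) = a *: lcomb w.
Proof.
by rewrite /lcomb scaler_sumr; apply: eq_bigr => j _; rewrite mxE scalerA.
Qed.

Definition frame_basis (b : 'cV[L]_r) j l := moore (b l 0 *: f j).

Lemma comb_frame_basis (b : 'cV_r) x : x \is a mxOver (Fq 1) ->
  comb (frame_basis b) x = moore (lcomb (x *m b)).
Proof.
move=> /mxOverP xF; rewrite mooreE /lcomb sparse_moore_sum;
  apply: eq_bigr => i _.
rewrite mxE scaler_suml sparse_moore_sum; apply: eq_bigr => j _.
by rewrite /frame_basis -scalerA sparse_mooreZ // mooreE.
Qed.

Hypothesis lcomb_inj : forall w, w \is a mxOver (Fq r) -> lcomb w = 0 -> w = 0.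

(** Field reduction: the products of the frame with an F_q-basis of F_{q^r} are independent over
    F_q. The last two clauses give the coordinate bijection for the same [b], with which the spread
    elements are later described. *)
Lemma frame_projectivity : exists b : 'cV[L]_r, [/\ is_Fq_basis q b,
  projectivity q 1 (frame_basis b) frame_space,
  forall a (z : 'M_(a, r)), z \is a mxOver (Fq 1) -> z *m b = 0 -> z = 0 &
  forall a (w : 'cV_a), w \is a mxOver (Fq r) ->
     exists2 z : 'M_(a, r), z \is a mxOver (Fq 1) & z *m b = w].
Proof.
have [|b] := @Fq_basis_mx 1 r (ltnSn 0) r_gt0; rewrite ?mul1n //.
move=> [bF inj surj].
have bxF a (x : 'M_(a, r)) : x \is a mxOver (Fq 1) ->
  x *m b \is a mxOver (Fq r).
  move=> /mxOverP xF; apply: Fq_mulmx => //.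
  by apply/mxOverP=> i j; apply: (Fq_dvd (dvd1n r)).
exists b; split=> //.
  split=> // a aF; have [|z zF zb] := surj 1 a%:M.
    by apply/mxOverP=> i j; rewrite !ord1 mxE eqxx mulr1n.
  exists z; split=> // z' [z'F z'b]; apply/eqP; rewrite -subr_eq0; apply/eqP.
  apply: inj; last by rewrite mulmxBl zb z'b subrr.
  by apply/mxOverP=> i j; rewrite !mxE FqD ?FqN ?(mxOverP zF) ?(mxOverP z'F).
have -> : frame_space = [set pt (comb (frame_basis b) x) | x in nzmx q L 1 m r].
  apply/setP=> P; apply/imsetP/imsetP=> -[w /mem_nzmx[w0 wF] ->].
    have [x xF xb] := surj m w wF; exists x;
      last by rewrite comb_frame_basis // xb.
    by apply/mem_nzmx; split=> //; apply: contraNneq w0 => x0;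
      rewrite -xb x0 mul0mx.
  exists (w *m b); last by rewrite comb_frame_basis.
  apply/mem_nzmx; split; last exact: bxF.
  by apply: contraNneq w0 => /(inj _ _ wF)->.
apply: fixed_projectivity => // [i j|x xF].
  by rewrite /frame_basis mooreE sparse_moore_fix.
rewrite comb_frame_basis // mooreE => /eqP; rewrite sparse_moore_eq0 => /eqP x0.
by apply/(inj _ _ xF)/lcomb_inj; first exact: bxF.
Qed.

Hypothesis m_gt0 : (0 < m)%N.

Lemma frame_subspace : subspace_of (Pi q L h k) (m * r).-1 frame_space.
Proof.
have [b [_ pr _ _]] := frame_projectivity.
apply: projectivity_subspace pr => // [i j|]; last by rewrite muln_gt0 m_gt0.
by rewrite /frame_basis mooreE sparse_moore_fix.
Qed.

End Frame.

Lemma lcomb1 (v : 'rV[L]_k) (w : 'cV_1) : lcomb (fun=> v) w = w 0 0 *: v.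
Proof. by rewrite /lcomb big_ord1. Qed.

(** Reduces the dimension of a spread element to that of a frame of one vector. *)
Lemma spread_at_frame v : spread_at v = frame_space (fun _ : 'I_1 => v).
Proof.
apply/setP=> P; apply/imsetP/imsetP=> [[a /Fq_unitsP[a0 aF] ->]|[w]].
  exists a%:M; last by rewrite lcomb1 mxE eqxx mulr1n.
  apply/mem_nzmx; split.
    by apply: contraNneq a0 => /matrixP/(_ 0 0); rewrite !mxE eqxx mulr1n => ->.
  by apply/mxOverP=> i j; rewrite !ord1 mxE eqxx mulr1n.
case/mem_nzmx=> w0 /mxOverP wF ->; exists (w 0 0); last by rewrite lcomb1.
apply/Fq_unitsP; split=> //; apply: contraNneq w0 => w0.
by apply/eqP/matrixP=> i j; rewrite !ord1 w0 mxE.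
Qed.

Lemma spread_at_subspace v : v != 0 ->
  subspace_of (Pi q L h k) r.-1 (spread_at v).
Proof.
move=> v0; rewrite spread_at_frame -{1}[r]mul1n;
  apply: frame_subspace => // w _ /eqP.
rewrite lcomb1 scaler_eq0 (negPf v0) orbF => /eqP w0.
by apply/matrixP=> i j; rewrite !ord1 w0 mxE.
Qed.

Lemma spread_atZ a v : a \in Fq_units -> spread_at (a *: v) = spread_at v.
Proof.
case/Fq_unitsP=> a0 aF; apply/setP=> P;
  apply/imsetP/imsetP=> -[b /Fq_unitsP[b0 bF] ->].
  exists (b * a); last by rewrite scalerA.
  by apply/Fq_unitsP; rewrite mulf_neq0 ?FqM.
exists (b / a); last by rewrite scalerA divfK.
by apply/Fq_unitsP; rewrite mulf_neq0 ?invr_eq0 ?FqM ?FqV.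
Qed.

(** * The Desarguesian spread of a frame space *)

Section FrameSpread.

Variables (m : nat) (f : 'I_m -> 'rV[L]_k).
Hypothesis m_gt0 : (0 < m)%N.
Hypothesis lcomb_inj : forall w, w \is a mxOver (Fq r) -> lcomb f w = 0 ->
  w = 0.

(** The coordinates w identify the frame space with F_{q^r}^m, and [spread_at] of the vector with
    coordinates w is the image of the line F_{q^r} w; the basis [b] then turns w into
    F_q-coordinates. *)
Lemma frame_desarguesian : desarguesian_spread q r m (frame_space f)
  [set spread_at (lcomb f w) | w in nzmx q L r m 1].
Proof.
have l_neq0 w : w \in nzmx q L r m 1 -> lcomb f w != 0.
  by case/mem_nzmx=> w0 wF; apply: contraNneq w0 => /(lcomb_inj wF)->.
have coverE : cover [set spread_at (lcomb f w) | w in nzmx q L r m 1] =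
  frame_space f.
  apply/setP=> P; apply/bigcupP/imsetP=> [[_ /imsetP[w /mem_nzmx[w0 wF] ->]]|[w
    wnz ->]].
    case/imsetP=> a /Fq_unitsP[a0 aF] ->; exists (a *: w);
      last by rewrite lcombZ.
    by apply/mem_nzmx; rewrite scaler_eq0 negb_or a0 Fq_scalemx.
  exists (spread_at (lcomb f w)); first exact: imset_f.
  by apply/imsetP; exists 1; rewrite ?scale1r //; apply/Fq_unitsP;
    rewrite oner_eq0 Fq1.
split.
  apply/andP; split.
    apply: partition_imset => // [w wnz|w w' P wnz w'nz].
      apply/set0Pn; exists (pt (moore (lcomb f w))); apply/imsetP; exists 1.
        by apply/Fq_unitsP; rewrite oner_eq0 Fq1.
      by rewrite scale1r.
    case/imsetP=> a aF ->; have [a0 aF'] := Fq_unitsP _ aF.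
    case/imsetP=> b bF; case/pt_moore_eq.
      by rewrite scaler_eq0 negb_or a0 l_neq0.
    (* A common point makes the two vectors proportional over F_{q^r}, hence the two elements
       equal. *)
    move=> c cF eq_ww'; rewrite -(spread_atZ _ aF) eq_ww' scalerA spread_atZ //.
    have [b0 bF'] := Fq_unitsP _ bF; apply/Fq_unitsP.
    rewrite mulf_neq0 ?FqM //; first by apply: Fq_dvd cF; apply: dvd1n.
    apply: contraNneq (l_neq0 _ wnz) => c0; move/eqP: eq_ww'.
    by rewrite c0 scale0r scaler_eq0 (negPf a0).
  apply/forall_inP=> S SD; have [w wnz defS] := imsetP SD.
  apply: (@subspace_of_sub _ _ _ (Pi q L h k)).
  - by rewrite defS spread_at_subspace ?l_neq0.
  - by rewrite -coverE (bigcup_max S).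
  - by case/andP: (frame_subspace lcomb_inj m_gt0) => /eqP-> _; apply: subsetIl.
have [b [b_basis pr inj surj]] := frame_projectivity lcomb_inj.
exists b, (frame_basis f b); split=> //; apply: eq_in_imset => w wnz.
have [w0 wF] := mem_nzmx _ _ wnz.
apply/setP=> P; apply/imsetP/imsetP=> [[a /Fq_unitsP[a0 aF] ->]|[x]].
  have [x xF xb] := surj _ (a *: w) (Fq_scalemx aF wF).
  exists x; last by rewrite comb_frame_basis // xb lcombZ.
  rewrite inE; apply/andP; split; last by apply/exists_inP; exists a;
    rewrite ?xb.
  apply/mem_nzmx; split=> //; apply: contraNneq w0 => x0.
  by move/eqP: xb; rewrite x0 mul0mx eq_sym scaler_eq0 (negPf a0).
rewrite inE => /andP[/mem_nzmx[x0 xF] /exists_inP[a aF /eqP xb]] ->.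
exists a; last by rewrite comb_frame_basis // xb lcombZ.
apply/Fq_unitsP; split=> //; apply: contraNneq x0 => a0; apply/eqP/(inj _ _ xF).
by rewrite xb a0 scale0r.
Qed.

End FrameSpread.

(** * The Segre variety of Theta_r and its two reguli *)

Section Reguli.

Hypothesis r_lt_h : (r < h)%N.
Hypothesis k_gt0 : (0 < k)%N.
Variable b : 'cV[L]_t.
Hypothesis b_inj : forall m (z : 'M_(m, t)),
  z \is a mxOver (Fq r) -> z *m b = 0 -> z = 0.
Hypothesis b_surj : forall m (w : 'cV_m),
  exists2 z : 'M_(m, t), z \is a mxOver (Fq r) & z *m b = w.

(** Here [b] is a basis of [L] over F_{q^r}; the coordinates x stand for the point of Theta_r given
    by the vector with i-th entry the sum of the x_ij b_j. *)
Definition Theta_basis (i : 'I_k) (j : 'I_t) : V :=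
  smoore r (b j 0 *: delta_mx 0 i).

Local Notation e := Theta_basis.

Lemma comb_Theta_basis x : x \is a mxOver (Fq r) ->
  comb e x = smoore r (x *m b)^T.
Proof.
move=> /mxOverP xF; rewrite [(x *m b)^T]row_sum_delta sparse_moore_sum.
apply: eq_bigr => i _; rewrite !mxE scaler_suml sparse_moore_sum.
by apply: eq_bigr => j _; rewrite -scalerA sparse_mooreZ.
Qed.

Lemma Theta_basis_projectivity : projectivity q r e (Theta_ q L h k r t).
Proof.
have -> : Theta_ q L h k r t = [set pt (comb e x) | x in nzmx q L r k t].
  rewrite Theta_E; apply/setP=> P; apply/imsetP/imsetP=> [[w]|[x]].
    rewrite in_setC1 => w0 ->; have [x xF xb] := b_surj w^T.
    exists x; last by rewrite comb_Theta_basis // xb trmxK.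
    apply/mem_nzmx; split=> //; apply: contraNneq w0 => x0.
    by rewrite -trmx_eq0 -xb x0 mul0mx.
  case/mem_nzmx=> x0 xF ->; exists (x *m b)^T; last by rewrite comb_Theta_basis.
  by rewrite in_setC1 trmx_eq0; apply: contraNneq x0 => /(b_inj xF)->.
apply: fixed_projectivity => // [i j|x xF]; first exact: sparse_moore_fix.
rewrite comb_Theta_basis // => /eqP; rewrite sparse_moore_eq0 trmx_eq0.
by move/eqP/(b_inj xF).
Qed.

(** The F_{q^r}-linear bijection from F_{q^r}^t to [L] given by the basis [b]. *)
Let val (y : 'rV[L]_t) := (y *m b) 0 0.

Let valE y : y *m b = (val y)%:M.
Proof. by apply/matrixP=> i j; rewrite !ord1 [RHS]mxE eqxx mulr1n. Qed.

Lemma imset_val (T : finType) (F : L -> T) :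
  [set F (val y) | y in nzmx q L r 1 t] = [set F a | a in [set~ 0]].
Proof.
apply/setP=> z; apply/imsetP/imsetP=> [[y /mem_nzmx[y0 yF] ->]|[a]].
  exists (val y); rewrite // in_setC1; apply: contraNneq y0 => vy0.
  by apply/eqP/(b_inj yF); rewrite valE vy0 raddf0.
rewrite in_setC1 => a0 ->; have [y yF yb] := b_surj (a%:M : 'M_1).
exists y; last by rewrite /val yb mxE eqxx mulr1n.
apply/mem_nzmx; split=> //; apply: contraNneq a0 => y0.
by move/matrixP/(_ 0 0): yb; rewrite y0 mul0mx !mxE eqxx mulr1n => <-.
Qed.

(** Rank-one coordinates become products of a scalar of [L] and a vector over F_{q^r}; this is what
    ties the Segre variety to the vectors a x. *)
Lemma comb_segre x y : x \in nzmx q L r 1 k -> y \in nzmx q L r 1 t ->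
  comb e (x^T *m y) = smoore r (val y *: x).
Proof.
case/mem_nzmx=> _ xF /mem_nzmx[_ yF]; rewrite comb_Theta_basis.
  by rewrite -mulmxA valE mul_mx_scalar linearZ /= trmxK.
by apply: Fq_mulmx => //; apply/mxOverP=> i j; rewrite mxE (mxOverP xF).
Qed.

Definition Lambda a : {set {set V}} :=
  [set pt (moore (a *: x)) | x in nzmx q L r 1 k].

Lemma pi_E x : pi_ q h x = \bigcup_(a in [set~ 0]) spread_at (a *: x).
Proof.
apply/setP=> P; apply/imsetP/bigcupP=> [[a a0 ->]|[a]].
  exists a => //; apply/imsetP; exists 1; rewrite ?scale1r //.
  by apply/Fq_unitsP; rewrite oner_neq0 Fq1.
rewrite in_setC1 => a0 /imsetP[c /Fq_unitsP[c0 _] ->].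
by exists (c * a); rewrite ?in_setC1 ?mulf_neq0 // scalerA.
Qed.

Lemma LambdaE a : Lambda a = \bigcup_(x in nzmx q L r 1 k) spread_at (a *: x).
Proof.
apply/setP=> P; apply/imsetP/bigcupP=> [[x xnz ->]|[x /mem_nzmx[x0 xF]]].
  exists x => //; apply/imsetP; exists 1; rewrite ?scale1r //.
  by apply/Fq_unitsP; rewrite oner_neq0 Fq1.
case/imsetP=> c /Fq_unitsP[c0 cF] ->; exists (c *: x).
  by apply/mem_nzmx; rewrite scaler_eq0 negb_or c0 Fq_scalemx.
by rewrite scalerA mulrC -scalerA.
Qed.

Lemma spread_union_imset (I : finType) (F : I -> 'rV[L]_k) (D : {set I}) :
  (forall i, i \in D -> F i != 0) ->
  spread_union q r [set pt (smoore r (F i)) | i in D] =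
  \bigcup_(i in D) spread_at (F i).
Proof.
move=> F0; apply/setP=> P; apply/bigcupP/bigcupP=> [[_ /imsetP[i iD ->]]|[i
  iD]].
  by rewrite spread_elt_smoore ?F0 //; exists i.
rewrite -spread_elt_smoore ?F0 // => PF; exists (pt (smoore r (F i))) => //.
by apply/imsetP; exists i.
Qed.

Lemma spread_union_cover (R : {set {set {set V}}}) :
  spread_union q r (cover R) = cover [set spread_union q r S | S in R].
Proof.
apply/setP=> P; apply/bigcupP/bigcupP=> [[X /bigcupP[S SR XS] PX]|].
  by exists (spread_union q r S); [apply: imset_f | apply/bigcupP; exists X].
case=> _ /imsetP[S SR ->] /bigcupP[X XS PX].
by exists X => //; apply/bigcupP; exists S.
Qed.

Lemma segre_regulus_fst : segre q r e = cover (regulus_fst q r e).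
Proof.
apply/setP=> P; apply/imset2P/bigcupP=> [[x y xnz ynz ->]|[_ /imsetP[x xnz
  ->]]].
  exists [set pt (comb e (x^T *m y)) | y in nzmx q L r 1 t];
    first by apply/imsetP; exists x.
  by apply/imsetP; exists y.
by case/imsetP=> y ynz ->; exists x y.
Qed.

Lemma segre_regulus_snd : segre q r e = cover (regulus_snd q r e).
Proof.
apply/setP=> P; apply/imset2P/bigcupP=> [[x y xnz ynz ->]|[_ /imsetP[y ynz
  ->]]].
  exists [set pt (comb e (x^T *m y)) | x in nzmx q L r 1 k];
    first by apply/imsetP; exists y.
  by apply/imsetP; exists x.
by case/imsetP=> x xnz ->; exists x y.
Qed.

(** Fixing x and letting y vary, the scalar [val y] runs over all of L^*, and the spread elements at
    the multiples of x fill [pi_ q h x]. *)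
Lemma Rh_regulus : Rh q L h k r =
  [set spread_union q r S | S in regulus_fst q r e].
Proof.
rewrite -imset_comp; apply: eq_in_imset => x xnz;
  have [x0 _] := mem_nzmx _ _ xnz.
rewrite /= (eq_in_imset (g := fun y => pt (smoore r (val y *: x)))); last first.
  by move=> y ynz; rewrite comb_segre.
rewrite (imset_val (fun a =>
  pt (smoore r (a *: x)))) spread_union_imset ?pi_E //.
by move=> a; rewrite in_setC1 => a0; rewrite scaler_eq0 negb_or a0.
Qed.

(** Fixing y freezes the scalar a = [val y], while x runs over the nonzero vectors of F_{q^r}^k. *)
Lemma Rkr_E : [set spread_union q r S | S in regulus_snd q r e] =
  [set Lambda a | a in [set~ 0]].
Proof.
rewrite -imset_comp -imset_val; apply: eq_in_imset => y ynz.
have vy0 : val y != 0.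
  have : val y \in [set a | a in [set~ 0 : L]] by rewrite -imset_val imset_f.
  by rewrite imset_id in_setC1.
rewrite /= (eq_in_imset (g := fun x => pt (smoore r (val y *: x)))); last first.
  by move=> x xnz; rewrite comb_segre.
rewrite spread_union_imset ?LambdaE // => x /mem_nzmx[x0 _].
by rewrite scaler_eq0 negb_or vy0.
Qed.

Lemma genSegreE : genSegre q L h k r = spread_union q r (segre q r e).
Proof. by rewrite segre_regulus_fst spread_union_cover -Rh_regulus. Qed.

(** Passes between the column coordinates of frames and the row coordinates of the reguli. *)
Lemma imset_nzmx_tr (T : finType) s m (F : 'cV[L]_m -> T) :
  [set F w | w in nzmx q L s m 1] = [set F y^T | y in nzmx q L s 1 m].
Proof.
have nzT a c (x : 'M[L]_(a, c)) : x \in nzmx q L s a c ->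
  x^T \in nzmx q L s c a.
  case/mem_nzmx=> x0 xF; apply/mem_nzmx; rewrite trmx_eq0; split=> //.
  by apply/mxOverP=> i j; rewrite mxE (mxOverP xF).
apply/setP=> z; apply/imsetP/imsetP=> -[x xnz ->]; exists x^T;
  rewrite ?trmxK ?nzT //.
Qed.

Lemma lcomb_pi x w : lcomb (fun j => b j 0 *: x) w = val w^T *: x.
Proof.
rewrite /lcomb /val mxE scaler_suml; apply: eq_bigr => j _.
by rewrite scalerA mxE.
Qed.

Lemma lcomb_Lambda a w : lcomb (fun i => a *: delta_mx 0 i) w = a *: w^T.
Proof.
rewrite [in RHS](row_sum_delta w^T) scaler_sumr; apply: eq_bigr => i _.
by rewrite !scalerA mulrC mxE.
Qed.

Lemma lcomb_pi_inj x w : x != 0 -> w \is a mxOver (Fq r) ->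
  lcomb (fun j => b j 0 *: x) w = 0 -> w = 0.
Proof.
move=> x0 wF /eqP; rewrite lcomb_pi scaler_eq0 (negPf x0) orbF => /eqP vw0.
apply: trmx_inj; rewrite trmx0; apply: b_inj; last by rewrite valE vw0 raddf0.
by apply/mxOverP=> i j; rewrite mxE (mxOverP wF).
Qed.

Lemma lcomb_Lambda_inj a w : a != 0 ->
  lcomb (fun i => a *: delta_mx 0 i) w = 0 -> w = 0.
Proof.
move=> a0 /eqP; rewrite lcomb_Lambda scaler_eq0 (negPf a0) trmx_eq0.
by move/eqP.
Qed.

Lemma pi_frame x : pi_ q h x = frame_space (fun j => b j 0 *: x).
Proof.
rewrite /frame_space imset_nzmx_tr -[LHS](imset_val (fun a =>
  pt (moore (a *: x)))).
by apply: eq_imset => y; rewrite lcomb_pi trmxK.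
Qed.

Lemma Lambda_frame a : Lambda a = frame_space (fun i => a *: delta_mx 0 i).
Proof.
rewrite /frame_space imset_nzmx_tr.
by apply: eq_imset => y; rewrite lcomb_Lambda trmxK.
Qed.

(** If cx = d a y with d in F_q and y over F_{q^r}, then (c/a) x has entries in F_{q^r}; as x is
    nonzero over that field, c/a belongs to it. *)
Lemma pi_Lambda x a : x \in nzmx q L r 1 k -> a != 0 ->
  pi_ q h x :&: Lambda a = spread_at (a *: x).
Proof.
case/mem_nzmx=> x0 xF a0; apply/setP=> P; rewrite in_setI.
apply/andP/imsetP=> [[/imsetP[c c0 ->] /imsetP[y /mem_nzmx[y0 yF]]]|[c]].
  rewrite in_setC1 in c0; case/pt_moore_eq;
    first by rewrite scaler_eq0 negb_or c0.
  move=> d dF eq_xy; exists (c / a); last by rewrite scalerA divfK.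
  apply/Fq_unitsP; rewrite mulf_neq0 ?invr_eq0 //; split=> //.
  apply: (Fq_scalemxr x0 xF).
  have -> : (c / a) *: x = d *: y.
    by rewrite mulrC -scalerA eq_xy !scalerA -mulrA mulrCA mulVf // mulr1.
  by apply: Fq_scalemx => //; apply: Fq_dvd dF; apply: dvd1n.
case/Fq_unitsP=> c0 cF ->; split; apply/imsetP.
  by exists (c * a); rewrite ?scalerA // in_setC1 mulf_neq0.
exists (c *: x); last by rewrite !scalerA mulrC.
by apply/mem_nzmx; rewrite scaler_eq0 negb_or c0 Fq_scalemx.
Qed.

(** The same descent as for [pi_Lambda], applied to a x = d a' x'; with [LambdaZ] it makes members
    that meet equal. *)
Lemma Lambda_meet a a' P : a != 0 -> P \in Lambda a -> P \in Lambda a' ->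
  exists2 c, c \in Fq_units & a = c * a'.
Proof.
move=> a0 /imsetP[x /mem_nzmx[x0 xF] ->] /imsetP[x' /mem_nzmx[x'0 x'F]].
case/pt_moore_eq=> [|d dF]; first by rewrite scaler_eq0 negb_or a0.
rewrite scalerA => eq_xx'.
have a'0 : a' != 0.
  apply: contraNneq a0 => a'0; move/eqP: eq_xx'.
  by rewrite a'0 mulr0 scale0r scaler_eq0 (negPf x0) orbF.
exists (a / a'); last by rewrite divfK.
apply/Fq_unitsP; rewrite mulf_neq0 ?invr_eq0 //; split=> //.
apply: (Fq_scalemxr x0 xF).
have -> : (a / a') *: x = d *: x'.
  by rewrite mulrC -scalerA eq_xx' scalerA mulrCA mulVf // mulr1.
by apply: Fq_scalemx => //; apply: Fq_dvd dF; apply: dvd1n.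
Qed.

Lemma LambdaZ c a : c \in Fq_units -> Lambda (c * a) = Lambda a.
Proof.
move=> cU; rewrite !LambdaE; apply: eq_bigr => x _.
by rewrite -scalerA spread_atZ.
Qed.

Lemma mem_Lambda a : exists P, P \in Lambda a.
Proof.
exists (pt (moore (a *: delta_mx 0 (Ordinal k_gt0)))); apply: imset_f.
apply/mem_nzmx; split.
  by apply/matrix0Pn; exists 0, (Ordinal k_gt0); rewrite mxE !eqxx oner_neq0.
by apply/mxOverP=> i j; rewrite mxE; case: (_ && _); rewrite ?Fq0 ?Fq1.
Qed.

Lemma Rkr_partition :
  partition [set Lambda a | a in [set~ 0]] (genSegre q L h k r).
Proof.
apply: partition_imset => [a _|a a' P|].
- by apply/set0Pn; apply: mem_Lambda.
- rewrite !in_setC1 => a0 _ Pa Pa'; have [c cU ->] := Lambda_meet a0 Pa Pa'.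
  exact: LambdaZ.
- by rewrite -Rkr_E -spread_union_cover -segre_regulus_snd genSegreE.
Qed.

(** The fibres of [Lambda] on L^* are the cosets of F_{q^r}^*, each with q^r - 1 elements. *)
Lemma card_Rkr : #|[set Lambda a | a in [set~ 0]]| =
  ((q ^ h - 1) %/ (q ^ r - 1))%N.
Proof.
have cardU : #|Fq_units| = (q ^ r - 1)%N.
  rewrite -(card_Fq (s := r)) // (cardD1 0 (Fq r)) Fq0 add1n subn1 /=.
  by apply: eq_card => a; rewrite !inE.
have qr_gt1 : (1 < q ^ r)%N by rewrite -(expn0 q) ltn_exp2l.
have -> : (q ^ h - 1 = \sum_(a in [set~ (0%R : L)]) 1)%N.
  by rewrite sum1_card cardsC1 card_L subn1.
rewrite (partition_big_imset Lambda) /=.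
rewrite (eq_bigr (fun=> (q ^ r - 1)%N)) => [|_ /imsetP[a a0 ->]].
  by rewrite sum_nat_const mulnK // subn_gt0.
rewrite in_setC1 in a0.
rewrite sum1_card -cardU -[RHS](card_imset _ (mulIf a0)); apply: eq_card => a'.
rewrite [LHS]inE ?in_setC1; apply/andP/imsetP => [[a'0 /eqP eq_aa']|[c cU ->]].
  have [P Pa'] := mem_Lambda a'; have Pa : P \in Lambda a by rewrite -eq_aa'.
  by have [c cU ->] := Lambda_meet a'0 Pa' Pa; exists c.
by have [c0 _] := Fq_unitsP _ cU; rewrite mulf_neq0 // LambdaZ.
Qed.

Lemma Theta_basis_reguli :
  projectivity q r e (Theta_ q L h k r t) /\
    let Rkr := [set spread_union q r S | S in regulus_snd q r e] in
    [/\
      [/\ genSegre q L h k r = spread_union q r (segre q r e),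
          Rh q L h k r = [set spread_union q r S | S in regulus_fst q r e] &
          forall G, G \in Rh q L h k r -> subspace_of (Pi q L h k) h.-1 G],
      [/\ #|Rkr| = ((q ^ h - 1) %/ (q ^ r - 1))%N,
          forall G, G \in Rkr -> subspace_of (Pi q L h k) (k * r).-1 G &
          partition Rkr (genSegre q L h k r)] &
      (forall G, G \in Rh q L h k r ->
         desarguesian_spread q r t G [set G :&: G' | G' in Rkr]) /\
      (forall G, G \in Rkr ->
         desarguesian_spread q r k G [set G :&: G' | G' in Rh q L h k r])].
Proof.
split; first exact: Theta_basis_projectivity.
rewrite /= Rkr_E; split.
- split; [exact: genSegreE | exact: Rh_regulus |].
  (* The t vectors b_j x form a frame of the space L x, so the vector dimension over F_q is tr =
     h. *)
  move=> _ /imsetP[x /mem_nzmx[x0 _] ->]; rewrite pi_frame [in h.-1]h_def mulnC.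
  by apply: frame_subspace => // w; apply: lcomb_pi_inj.
- split; [exact: card_Rkr | | exact: Rkr_partition].
  move=> _ /imsetP[a a0 ->]; rewrite in_setC1 in a0; rewrite Lambda_frame.
  by apply: frame_subspace => // w _; apply: lcomb_Lambda_inj.
split=> [_ /imsetP[x xnz ->]|_ /imsetP[a a0 ->]].
  have [x0 xF] := mem_nzmx _ _ xnz.
  rewrite -imset_comp (eq_in_imset (g := fun a => spread_at (a *: x)));
    last first.
    by move=> a; rewrite in_setC1 => a0; apply: pi_Lambda.
  rewrite -(imset_val (fun a => spread_at (a *: x))) pi_frame.
  rewrite (eq_imset (g := fun y => spread_at (lcomb (fun j =>
    b j 0 *: x) y^T))).
    rewrite -(imset_nzmx_tr _ (fun w => spread_at (lcomb (fun j =>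
      b j 0 *: x) w))).
    by apply: frame_desarguesian => // w; apply: lcomb_pi_inj.
  by move=> y; rewrite lcomb_pi trmxK.
rewrite in_setC1 in a0.
rewrite -imset_comp (eq_in_imset (g := fun x => spread_at (a *: x)));
  last first.
  by move=> x xnz; rewrite /= setIC pi_Lambda.
rewrite Lambda_frame.
rewrite (eq_imset (g := fun y => spread_at (lcomb (fun i =>
  a *: delta_mx 0 i) y^T))).
  rewrite -(imset_nzmx_tr _ (fun w => spread_at (lcomb (fun i =>
    a *: delta_mx 0 i) w))).
  by apply: frame_desarguesian => // w _; apply: lcomb_Lambda_inj.
by move=> y; rewrite lcomb_Lambda trmxK.
Qed.

End Reguli.

End SubfieldSpread.

End GeneralizedSegre.

Theorem mainTheorem3 (p n q k h r t : nat) (L : finFieldType)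
    (p_prime : prime p) (n_gt0 : 0 < n) (q_def : q = p ^ n)
    (k_gt0 : 0 < k) (h_gt0 : 0 < h)
    (r_gt0 : 0 < r) (r_lt_h : r < h) (h_def : h = r * t)
    (card_L : #|L| = q ^ h) :
  exists e : 'I_k -> 'I_t -> 'M[L]_(h, k),
    projectivity q r e (Theta_ q L h k r t) /\
    let Rkr := [set spread_union q r S | S in regulus_snd q r e] in
    [/\
      [/\ genSegre q L h k r = spread_union q r (segre q r e),
          Rh q L h k r = [set spread_union q r S | S in regulus_fst q r e] &
          forall G, G \in Rh q L h k r -> subspace_of (Pi q L h k) h.-1 G],
      [/\ #|Rkr| = (q ^ h - 1) %/ (q ^ r - 1),
          forall G, G \in Rkr -> subspace_of (Pi q L h k) (k * r).-1 G &
          partition Rkr (genSegre q L h k r)] &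
      (forall G, G \in Rh q L h k r ->
         desarguesian_spread q r t G [set G :&: G' | G' in Rkr]) /\
      (forall G, G \in Rkr ->
         desarguesian_spread q r k G [set G :&: G' | G' in Rh q L h k r])].
Proof.
have q_gt1 : 1 < q by rewrite q_def -(expn0 p) ltn_exp2l // prime_gt1.
have t_gt0 : 0 < t.
  by rewrite lt0n; apply: contraTneq h_gt0 => t0; rewrite h_def t0 muln0.
have rt_h : (r * t %| h)%N by rewrite -h_def.
have [b [_ b_inj b_surj]] :=
  Fq_basis_mx p_prime q_def q_gt1 card_L r_gt0 t_gt0 rt_h.
eexists.
apply: (Theta_basis_reguli p_prime q_def q_gt1 h_gt0 card_L r_gt0 t_gt0 h_def
          r_lt_h k_gt0 b_inj) => m w.
(* As rt = h, the field F_{q^(rt)} is all of [L], so [b] represents every element of [L]. *)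
apply: b_surj; apply/mxOverP=> i j; apply/FqP.
by rewrite -h_def (frob_h card_L).
Qed.
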